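(* Let $A,B$ be positive definite $n\times n$ complex matrices and let $q<0$ be real. Then $$\operatorname{Tr}(A+B)^q=\operatorname{Tr}A^q+\operatorname{Tr}B^q+(2^q-2)\operatorname{Tr}\bigl(A^{1/2}BA^{1/2}\bigr)^{q/2}$$ if and only if $A=B$.
   Context: All matrices are finite-dimensional complex matrices. $\operatorname{Tr}$ is the usual non-normalized trace, and $\operatorname{Tr}Z^q$ means $\operatorname{Tr}(Z^q)$. Real powers of positive definite Hermitian matrices are defined by functional calculus. *)

(* Defs.v *)
From mathcomp Require Import all_boot all_order all_algebra.
From mathcomp Require Import complex reals exp.

Set Implicit Arguments.
Unset Strict Implicit.
Unset Printing Implicit Defensive.

Import Order.TTheory GRing.Theory Num.Theory.

Local Open Scope ring_scope.
Local Open Scope sesquilinear_scope.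
Local Open Scope complex_scope.

(* On R[i], [0 < z] says that z is real and positive. *)
Definition posdefmx (R : realType) (n : nat) (A : 'M[R[i]]_n) : Prop :=
  A \is hermsymmx /\
  (forall v : 'cV[R[i]]_n, v != 0 -> 0 < (v ^t* *m A *m v) 0 0).

(* Functional calculus.  By [orthomx_spectralP], a Hermitian matrix A is
   U^-1 *m diag_mx d *m U with U := spectralmx A unitary and
   d := spectral_diag A real, hence the use of [complex.Re].  The value is
   not meaningful when A is not Hermitian. *)
Definition mxfun (R : realType) (f : R -> R) (n : nat) (A : 'M[R[i]]_n) :
    'M[R[i]]_n :=
  invmx (spectralmx A) *m
  diag_mx (map_mx (fun z => (f (complex.Re z))%:C) (spectral_diag A)) *m
  spectralmx A.

(* [x `^ q] is exp (q ln x) for 0 < x; all eigenvalues of a positive definite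
   matrix satisfy this. *)
Definition mxpowR (R : realType) (n : nat) (A : 'M[R[i]]_n) (q : R) :
    'M[R[i]]_n :=
  mxfun (fun x : R => x `^ q) A.

(* Main.v *)
Require Import Defs.
From mathcomp Require Import all_boot all_order all_algebra.
From mathcomp Require Import perm complex reals sequences exp.
From mathcomp Require Import ring lra.

(** Write S for the square root of A, G = S B S, and let g_j and h_j be the
    eigenvalues of G and of A + B in nonincreasing order, with s_j = sqrt g_j;
    the s_j are the singular values of the product of the square roots of A
    and B.  The theorem follows from two inequalities.

    - [eigenvalueD_ge], the arithmetic-geometric mean inequality of Bhatia and
      Kittaneh: 2 s_j <= h_j for every j.  As q < 0, it gives
      Tr (A + B)^q <= 2^q Tr G^(q/2).
    - [mxtrace_powR_Hoelder]: 2 Tr G^(q/2) <= Tr A^q + Tr B^q.  This is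
      Hoelder's inequality for Schatten quasi-norms applied to the inverses of
      A and B, and it holds for every q <= 0.

    Their sum is Tr (A + B)^q <= Tr A^q + Tr B^q + (2^q - 2) Tr G^(q/2).  In
    the case of equality the first inequality is an equality too, so that
    h_j = 2 s_j for every j.  Summing squares, Tr (A + B)^2 = 4 Tr G =
    4 Tr (A B), which says Tr (A - B)^2 = 0, that is A = B.

    Both inequalities use matrices P and Q with A Q = P s, B P = Q s and
    Q^* A Q = P^* B P = 1, s being the diagonal matrix of the s_j ([pencil]).
    For the first one, the vectors x = (P + Q) s c, with c supported on the
    first j coordinates, form a subspace of dimension j on which the form
    A + B is at least 2 s_j times the squared norm, and the min-max principle
    ([eigenvalue_ge]) concludes.  For the second one, P^* Q is the inverse of
    s; restricting P and Q to the k columns with smallest s_j, the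
    Cauchy-Schwarz inequality for determinants ([det_CauchySchwarz]) and the
    interlacing of eigenvalues ([det_compression]) give Horn's inequality: the
    product of the k smallest eigenvalues of A and of B is at most that of the
    k smallest s_j^2 ([pencil_prod_le]).  Taking logarithms, summation by
    parts and the convexity of exp turn these inequalities into the one
    between sums of powers ([sum_powR_le]). *)

Set Implicit Arguments.
Unset Strict Implicit.
Unset Printing Implicit Defensive.

Import Order.TTheory GRing.Theory Num.Theory.

Local Open Scope ring_scope.
Local Open Scope sesquilinear_scope.

Section LinearAlgebra.
Context {C : numClosedFieldType}.

(** * Adjoints and quadratic forms *)

Lemma adjmxM m n p (A : 'M[C]_(m, n)) (B : 'M[C]_(n, p)) :
  (A *m B)^t* = B^t* *m A^t*.
Proof. by rewrite trmx_mul map_mxM. Qed.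

Lemma adjmxB m n (A B : 'M[C]_(m, n)) : (A - B)^t* = A^t* - B^t*.
Proof. by rewrite linearB map_mxB. Qed.

Lemma adjmxD m n (A B : 'M[C]_(m, n)) : (A + B)^t* = A^t* + B^t*.
Proof. by rewrite linearD map_mxD. Qed.

Lemma adjmxZ m n (r : C) (A : 'M[C]_(m, n)) : (r *: A)^t* = r^* *: A^t*.
Proof. by rewrite linearZ map_mxZ. Qed.

Lemma adjmx_gram m n (P : 'M[C]_(m, n)) : (P^t* *m P)^t* = P^t* *m P.
Proof. by rewrite adjmxM trmxCK. Qed.

Lemma det_adjmx n (A : 'M[C]_n) : \det (A^t*) = (\det A)^*.
Proof. by rewrite det_map_mx det_tr. Qed.

Lemma adjmx_inv n (A : 'M[C]_n) : A^t* = A -> (invmx A)^t* = invmx A.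
Proof. by move=> hA; rewrite trmx_inv map_invmx hA. Qed.

Lemma hermsymmxP n (A : 'M[C]_n) : reflect (A^t* = A) (A \is hermsymmx).
Proof.
apply: (iffP (is_hermitianmxP _ _ _)) => [{2}->|{1}<-];
  by rewrite expr0 scale1r.
Qed.

Lemma adjmx_diag n (a : 'rV[C]_n) :
  a \is a realmx -> (diag_mx a)^t* = diag_mx a.
Proof. by move=> ar; rewrite tr_diag_mx map_diag_mx realmxC. Qed.

(** The squared Euclidean norm of v. *)
Definition sqnormv n (v : 'cV[C]_n) : C := (v^t* *m v) 0 0.

(** The Hermitian form of A evaluated at v. *)
Definition qform n (A : 'M[C]_n) (v : 'cV[C]_n) : C := (v^t* *m A *m v) 0 0.

Lemma qform_diag n (a : 'rV[C]_n) v :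
  qform (diag_mx a) v = \sum_i a 0 i * `|v i 0| ^+ 2.
Proof.
rewrite /qform -mulmxA mxE; apply: eq_bigr => i _.
by rewrite mul_diag_mx !mxE normCKC mulrCA.
Qed.

Lemma qform1 n (v : 'cV[C]_n) : qform 1%:M v = sqnormv v.
Proof. by rewrite /qform mulmx1. Qed.

Lemma sqnormvE n (v : 'cV[C]_n) : sqnormv v = \sum_i `|v i 0| ^+ 2.
Proof.
by rewrite /sqnormv mxE; apply: eq_bigr => i _; rewrite !mxE normCKC.
Qed.

Lemma sqnormv_ge0 n (v : 'cV[C]_n) : 0 <= sqnormv v.
Proof.
by rewrite sqnormvE sumr_ge0 // => i _; rewrite exprn_ge0 ?normr_ge0.
Qed.

Lemma sqnormv_eq0 n (v : 'cV[C]_n) : (sqnormv v == 0) = (v == 0).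
Proof.
rewrite sqnormvE psumr_eq0; last by move=> i _; rewrite exprn_ge0 ?normr_ge0.
apply/allP/eqP => [v0|-> i _]; last by rewrite mxE normr0 expr0n eqxx.
apply/colP => i; apply/eqP; rewrite mxE -normr_eq0 -sqrf_eq0.
by have := v0 i (mem_index_enum i).
Qed.

Lemma sqnormv_gt0 n (v : 'cV[C]_n) : (0 < sqnormv v) = (v != 0).
Proof. by rewrite lt_def sqnormv_eq0 sqnormv_ge0 andbT. Qed.

Lemma qformM m n (P : 'M[C]_(n, m)) (A : 'M[C]_n) v :
  qform A (P *m v) = qform (P^t* *m A *m P) v.
Proof. by rewrite /qform adjmxM !mulmxA. Qed.

Lemma sqnormvM m n (P : 'M[C]_(n, m)) v :
  sqnormv (P *m v) = qform (P^t* *m P) v.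
Proof. by rewrite -qform1 qformM mulmx1. Qed.

Lemma qformD n (A B : 'M[C]_n) v : qform (A + B) v = qform A v + qform B v.
Proof. by rewrite /qform mulmxDr mulmxDl mxE. Qed.

Lemma qformN n (A : 'M[C]_n) v : qform (- A) v = - qform A v.
Proof. by rewrite /qform mulmxN mulNmx mxE. Qed.

Lemma qformZ n r (A : 'M[C]_n) v : qform (r *: A) v = r * qform A v.
Proof. by rewrite /qform -scalemxAr -scalemxAl mxE. Qed.

Lemma mxtrace_adjmx_eq0 n (M : 'M[C]_n) : \tr (M^t* *m M) = 0 -> M = 0.
Proof.
have E i : (M^t* *m M) i i = sqnormv (col i M).
  by rewrite sqnormvE mxE; apply: eq_bigr => k _; rewrite !mxE normCKC.
rewrite /mxtrace (eq_bigr _ (fun i _ => E i)) => /eqP.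
rewrite psumr_eq0; last by move=> i _; exact: sqnormv_ge0.
move=> /allP M0; apply/matrixP => k i.
have := M0 i (mem_index_enum i); rewrite sqnormv_eq0 /= => /eqP/colP/(_ k).
by rewrite !mxE.
Qed.

Lemma mxtrace_sqrB n (A B : 'M[C]_n) :
  \tr ((A - B) *m (A - B)) = \tr ((A + B) *m (A + B)) - 4 * \tr (A *m B).
Proof.
have trN (M : 'M[C]_n) : \tr (- M) = - \tr M by rewrite raddfN.
rewrite mulmxBl !mulmxBr mulmxDl !mulmxDr opprB !mxtraceD !trN.
by rewrite (mxtrace_mulC B A); ring.
Qed.

(** * Ordered spectral decompositions *)

(** A spectral decomposition of A: the rows of U are conjugates of an
    orthonormal basis of eigenvectors, and a lists the eigenvalues. *)
Definition eigdec n (A U : 'M[C]_n) (a : 'rV[C]_n) : Prop :=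
  U \is unitarymx /\ A = U^t* *m diag_mx a *m U.

Lemma unitarymxC n (U : 'M[C]_n) : U \is unitarymx -> U^t* *m U = 1%:M.
Proof. by rewrite -trmxC_unitary => /unitarymxP; rewrite trmxCK. Qed.

(** The order of C is only partial; it can be used to sort the eigenvalues
    because they are real. *)
Lemma eigdec_exists n (A : 'M[C]_n) : A \is hermsymmx ->
  exists U a, [/\ eigdec A U a, a \is a realmx &
    forall i j : 'I_n, (i <= j)%N -> a 0 j <= a 0 i].
Proof.
move=> hA; have /orthomx_spectralP Adec := hermitian_normalmx hA.
have dr := hermitian_spectral_diag_real hA.
set U := spectralmx A in Adec; set d := spectral_diag A in Adec dr.
have Uu : U \is unitarymx by exact: spectral_unitarymx.
pose ge (x y : C) := y <= x.
pose t := [tuple d 0 i | i < n].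
pose t' := [tuple of sort ge t].
have /tuple_permP[p tp] : perm_eq t' t by rewrite perm_sort.
have t'E i : tnth t' i = d 0 (p i).
  have -> : tnth t' i = tnth [tuple tnth t (p i) | i < n] i.
    by congr tnth; apply: val_inj; rewrite /= -tp.
  by rewrite !tnth_mktuple.
(* Sorting the eigenvalues by p permutes the rows of U accordingly. *)
exists (row_perm p U), (\row_i d 0 (p i)); split.
- split.
    apply/unitarymxP; rewrite row_permE adjmxM mulmxA -(mulmxA _ U).
    move/unitarymxP: Uu => ->; rewrite mulmx1.
    rewrite /perm_mx; apply/matrixP=> i j; rewrite !mxE.
    under eq_bigr do rewrite !mxE.
    rewrite (bigD1 (p i)) //= eqxx mul1r big1 ?addr0.
      by rewrite (inj_eq perm_inj) conjC_nat eq_sym.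
    by move=> k /negPf kp; rewrite eq_sym kp mul0r.
  rewrite Adec (invmx_unitary Uu); apply/matrixP => i j.
  rewrite -!mulmxA !mxE (reindex_inj (@perm_inj _ p)) /=.
  by apply: eq_bigr => k _; rewrite !mul_diag_mx !mxE.
- by apply/mxOverP => i j; rewrite mxE; move/mxOverP: dr => ->.
- move=> i j ij; rewrite !mxE -!t'E.
  have tot : {in Num.real &, total ge}.
    by move=> x y xr yr; rewrite /ge orbC; exact: real_leVge.
  have tr : all (mem Num.real) t.
    by apply/allP => x /mapP[k _ ->]; move/mxOverP: dr => /(_ 0 k).
  have st := sort_sorted_in tot tr.
  rewrite !(tnth_nth 0) -/(ge _ _); apply: sorted_leq_nth => //.
  + by move=> x y z /= yx xz; exact: le_trans xz yx.
  + by move=> x; exact: lexx.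
  + by rewrite inE size_sort size_tuple.
  + by rewrite inE size_sort size_tuple.
Qed.

Lemma qform_eigdec n (A U : 'M[C]_n) a v : eigdec A U a ->
  qform A v = \sum_i a 0 i * `|(U *m v) i 0| ^+ 2.
Proof. by case=> _ ->; rewrite -qform_diag qformM. Qed.

Lemma sqnormv_unitary n (U : 'M[C]_n) v : U \is unitarymx ->
  sqnormv (U *m v) = sqnormv v.
Proof. by move=> /unitarymxC U1; rewrite sqnormvM U1 qform1. Qed.

Lemma eigdec_eigenvalue n (A U : 'M[C]_n) a i : eigdec A U a ->
  exists2 v, v != 0 & a 0 i = qform A v.
Proof.
move=> Ad; have [/unitarymxP U1 _] := Ad.
have Uv : U *m (U^t* *m delta_mx i 0) = delta_mx i 0 :> 'cV_n.
  by rewrite mulmxA U1 mul1mx.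
exists (U^t* *m delta_mx i 0).
  apply/eqP => v0; have /colP/(_ i)/eqP := Uv.
  by rewrite v0 mulmx0 !mxE !eqxx eq_sym oner_eq0.
rewrite (qform_eigdec _ Ad) (bigD1 i) //= Uv mxE !eqxx normr1 expr1n mulr1.
by rewrite big1 ?addr0 // => k /negPf ki; rewrite mxE ki normr0 expr0n mulr0.
Qed.

Lemma eigdec_gt0 n (A U : 'M[C]_n) a i : eigdec A U a ->
  (forall v, v != 0 -> 0 < qform A v) -> 0 < a 0 i.
Proof. by move=> /eigdec_eigenvalue-/(_ i)[v v0 ->]; apply. Qed.

Lemma eigdec_det n (A U : 'M[C]_n) a : eigdec A U a -> \det A = \prod_i a 0 i.
Proof.
case=> /unitarymxC U1 ->; rewrite !det_mulmx det_diag mulrAC -det_mulmx U1.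
by rewrite det1 mul1r.
Qed.

Lemma eigdecN n (A U : 'M[C]_n) a : eigdec A U a -> eigdec (- A) U (- a).
Proof. by case=> ? ->; split=> //; rewrite linearN mulmxN mulNmx. Qed.

Lemma eigdec_inj n (A B U : 'M[C]_n) a : eigdec A U a -> eigdec B U a -> A = B.
Proof. by move=> [_ ->] [_ ->]. Qed.

Lemma eigdec_sqr n (A U : 'M[C]_n) a : eigdec A U a ->
  eigdec (A *m A) U (\row_i (a 0 i * a 0 i)).
Proof.
move=> [Uu ->]; split; first by [].
rewrite -mulmx_diag -!mulmxA; congr (_ *m (_ *m _)).
by rewrite !mulmxA (unitarymxP Uu) mul1mx.
Qed.

Lemma eigdec_double n (A U : 'M[C]_n) a : eigdec A U a ->
  eigdec (A + A) U (a + a).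
Proof. by move=> [Uu ->]; split; rewrite // linearD mulmxDr mulmxDl. Qed.

Lemma eigdec_herm n (A U : 'M[C]_n) a : eigdec A U a -> a \is a realmx ->
  A \is hermsymmx.
Proof.
case=> _ -> ar; apply/hermsymmxP.
by rewrite !adjmxM adjmx_diag // trmxCK mulmxA.
Qed.

Lemma mxtrace_eigdec n (A U : 'M[C]_n) a : eigdec A U a ->
  \tr A = \sum_i a 0 i.
Proof.
by case=> /unitarymxP UU ->; rewrite mxtrace_mulC mulmxA UU mul1mx mxtrace_diag.
Qed.

(** * Comparison of eigenvalues and of determinants *)

(** Among the vectors with only the first j + 1 coordinates nonzero, j linear
    conditions leave a nonzero solution. *)
Lemma dimension_count n k (M : 'M[C]_(n, k)) (j : nat) : (j < k)%N ->
  exists2 c : 'cV[C]_k, c != 0 &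
    (forall i : 'I_k, (j < i)%N -> c i 0 = 0) /\
    (forall i : 'I_n, (i < j)%N -> (M *m c) i 0 = 0).
Proof.
move=> jk.
(* All the conditions form one square system, whose row j is zero. *)
pose r (i : 'I_k) : 'rV[C]_k := if (j < i)%N then delta_mx 0 i else
  if (i < j)%N then (if insub (i : nat) is Some i' then row i' M else 0) else 0.
pose N := \matrix_i r i.
have detN : \det N = 0.
  rewrite (expand_det_row _ (Ordinal jk)) big1 // => i _.
  by rewrite !mxE /r /= ltnn mxE mul0r.
have /eqP/det0P[v v0 vN] : \det N^T = 0 by rewrite det_tr.
have Nv : N *m v^T = 0 by rewrite -[N]trmxK -trmx_mul vN trmx0.
have rv i : r i *m v^T = 0 by rewrite -(rowK r i) -row_mul Nv row0.
exists v^T; first by rewrite -(inj_eq trmx_inj) trmxK trmx0.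
split=> i ij.
  have /rowP/(_ 0) := rv i.
  by rewrite /r ij -rowE !mxE.
have ik : (i < k)%N := ltn_trans ij jk.
have /rowP/(_ 0) := rv (Ordinal ik).
by rewrite /r /= ltnNge (ltnW ij) /= ij valK -row_mul !mxE.
Qed.

(** Min-max principle: if the form of H is at least t times the squared norm
    on the image under K of the vectors supported on coordinates 0, ..., j,
    where K is injective, then the eigenvalue of index j is at least t.  The
    subspace has dimension j + 1, hence meets the span of the eigenvectors of
    index at least j. *)
Lemma eigenvalue_ge n k (H U : 'M[C]_n) a (K : 'M[C]_(n, k)) (j : 'I_n) t :
    eigdec H U a -> (forall i : 'I_n, (j <= i)%N -> a 0 i <= a 0 j) ->
    (j < k)%N ->
    (forall c : 'cV[C]_k, c != 0 -> (forall i : 'I_k, (j < i)%N -> c i 0 = 0) ->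
      K *m c != 0 /\ t * sqnormv (K *m c) <= qform H (K *m c)) ->
  t <= a 0 j.
Proof.
move=> Hd aj jk Kt; have [Uu _] := Hd.
have [c c0 [cj Mc]] := dimension_count (U *m K) jk.
have [x0 tx] := Kt c c0 cj; set x := K *m c in x0 tx.
rewrite -(ler_pM2r (_ : 0 < sqnormv x)) ?sqnormv_gt0 // (le_trans tx) //.
rewrite (qform_eigdec _ Hd) -(sqnormv_unitary x Uu) sqnormvE mulr_sumr.
apply: ler_sum => i _; case: (leqP j i) => ij.
  by rewrite ler_wpM2r ?exprn_ge0 // aj.
by rewrite /x mulmxA Mc // normr0 expr0n !mulr0.
Qed.

Lemma psd_det_le k (X Y : 'M[C]_k) : X \is hermsymmx -> Y \is hermsymmx ->
  (forall v, 0 <= qform Y v) -> (forall v, qform Y v <= qform X v) ->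
  \det Y <= \det X.
Proof.
move=> /eigdec_exists[U [x [Xd _ xs]]] /eigdec_exists[V [y [Yd _ ys]]] Y0 YX.
rewrite (eigdec_det Xd) (eigdec_det Yd); apply: ler_prod => j _.
apply/andP; split; first by have [v _ ->] := eigdec_eigenvalue j Yd.
have [Vu _] := Yd.
apply: (eigenvalue_ge (K := V^t*) Xd) => [i|//|c c0 cj]; first exact: xs.
have VcK : V *m (V^t* *m c) = c by rewrite mulmxA (unitarymxP Vu) mul1mx.
split.
  by apply/eqP => v0; move: c0; rewrite -VcK v0 mulmx0 eqxx.
apply: le_trans (YX _); rewrite (qform_eigdec _ Yd) -(sqnormv_unitary _ Vu) VcK.
rewrite sqnormvE mulr_sumr; apply: ler_sum => i _.
case: (leqP i j) => ij; first by rewrite ler_wpM2r ?exprn_ge0 // ys.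
by rewrite cj // normr0 expr0n !mulr0.
Qed.

(** The Cauchy-Schwarz inequality for determinants of Gram matrices: replace Q
    by its orthogonal projection Z onto the range of P, which lowers the Gram
    matrix of Q and turns the inequality into an equality. *)
Lemma det_CauchySchwarz n k (P Q : 'M[C]_(n, k)) : P^t* *m P \in unitmx ->
  `|\det (P^t* *m Q)| ^+ 2 <= \det (P^t* *m P) * \det (Q^t* *m Q).
Proof.
set M := P^t* *m P => Mu.
have Mi : (invmx M)^t* = invmx M by rewrite adjmx_inv // adjmx_gram.
have detM_gt0 : 0 < \det M.
  rewrite lt_def -unitfE -unitmxE Mu /=.
  have /eigdec_exists[U [m [Md _ _]]] : M \is hermsymmx.
    by apply/hermsymmxP; exact: adjmx_gram.
  rewrite (eigdec_det Md) prodr_ge0 // => i _.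
  have [v _ ->] := eigdec_eigenvalue i Md.
  by rewrite -sqnormvM sqnormv_ge0.
pose Z := P *m (invmx M *m (P^t* *m Q)).
have ZZ : Z^t* *m Z = (P^t* *m Q)^t* *m invmx M *m (P^t* *m Q).
  rewrite /Z adjmxM (adjmxM (invmx M)) Mi -!mulmxA (mulmxA (P^t*) P) -/M.
  by rewrite (mulmxA M) mulmxV // mul1mx.
have ZQ : Z^t* *m Q = Z^t* *m Z.
  by rewrite ZZ /Z adjmxM (adjmxM (invmx M)) Mi !mulmxA.
have QZ : Q^t* *m Z = Z^t* *m Z.
  by rewrite -[LHS]trmxCK adjmxM trmxCK ZQ adjmx_gram.
have RR : (Q - Z)^t* *m (Q - Z) + Z^t* *m Z = Q^t* *m Q.
  by rewrite adjmxB mulmxBl !mulmxBr ZQ QZ subrr subr0 subrK.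
have dZ : \det (Z^t* *m Z) = `|\det (P^t* *m Q)| ^+ 2 / \det M.
  by rewrite ZZ !det_mulmx det_adjmx det_inv normCKC; ring.
rewrite mulrC -ler_pdivrMr // -dZ; apply: psd_det_le.
- by apply/hermsymmxP; exact: adjmx_gram.
- by apply/hermsymmxP; exact: adjmx_gram.
- by move=> v; rewrite -sqnormvM sqnormv_ge0.
- by move=> v; rewrite -RR qformD lerDr -sqnormvM sqnormv_ge0.
Qed.

(** If P is orthonormal for the form H, then det (P^* P) is at most the product
    of the inverses of the k smallest eigenvalues of H.  By the min-max
    principle for - H, this bound even holds eigenvalue by eigenvalue. *)
Lemma det_compression n k (le_kn : (k <= n)%N) (H U : 'M[C]_n) b
    (P : 'M[C]_(n, k)) : eigdec H U b -> (forall i, 0 < b 0 i) ->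
    (forall i j : 'I_n, (i <= j)%N -> b 0 i <= b 0 j) ->
    P^t* *m H *m P = 1%:M ->
  0 < \det (P^t* *m P) <= \prod_(i < k) (b 0 (widen_ord le_kn i))^-1.
Proof.
move=> Hd b0 bs PHP; set M := P^t* *m P.
have /eigdec_exists[W [m [Md _ ms]]] : M \is hermsymmx.
  by apply/hermsymmxP; exact: adjmx_gram.
have [Wu _] := Md.
have Pinj (v : 'cV_k) : v != 0 -> P *m v != 0.
  apply: contra_neq => Pv.
  by rewrite -[v]mul1mx -PHP -!mulmxA Pv !mulmx0.
have m0 i : 0 < m 0 i.
  by apply: (eigdec_gt0 i Md) => v /Pinj; rewrite -sqnormvM sqnormv_gt0.
rewrite (eigdec_det Md) prodr_gt0 //=; apply: ler_prod => j _.
rewrite ltW //=; set j' := widen_ord _ _.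
(* m_j <= 1 / b_j is rewritten as - 1 / m_j <= - b_j, an eigenvalue of - H. *)
rewrite -[m 0 j]invrK lef_pV2 ?posrE ?invr_gt0 // -lerN2.
have -> : - b 0 j' = (- b) 0 j' by rewrite mxE.
apply: (eigenvalue_ge (j := j') (K := P *m W^t*) (eigdecN Hd))
  => [i ij||c c0 cj].
- by rewrite !mxE lerN2 bs.
- exact: (ltn_ord j).
have WcK : W *m (W^t* *m c) = c by rewrite mulmxA (unitarymxP Wu) mul1mx.
have w0 : W^t* *m c != 0.
  by apply: contra_neq c0 => w0; rewrite -WcK w0 mulmx0.
rewrite -mulmxA; split; first exact: Pinj.
rewrite qformN qformM PHP qform1 mulNr lerN2 (sqnormvM P) mulrC ler_pdivlMr //.
rewrite -/M (qform_eigdec _ Md) WcK -(sqnormv_unitary _ Wu) WcK sqnormvE.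
rewrite mulr_suml.
apply: ler_sum => i _; rewrite mulrC.
case: (leqP i j) => ij; first by rewrite ler_wpM2r ?exprn_ge0 // ms.
by rewrite cj // normr0 expr0n !mulr0.
Qed.

(** * The pencil attached to two positive definite matrices *)

(** A joint normal form of two Hermitian matrices.  For real s, it implies
    P^* B P = 1, and that P^* Q and Q^* P are inverse to the diagonal matrix s.  The number k of
    columns may be smaller than n, as for the restriction to some of the
    s_j. *)
Definition pencil n k (A B : 'M[C]_n) (P Q : 'M[C]_(n, k)) (s : 'rV[C]_k) :=
  [/\ A *m Q = P *m diag_mx s, B *m P = Q *m diag_mx s &
      Q^t* *m A *m Q = 1%:M].

(** With S a square root of A and G = S B S = U^* s^2 U, the choice is
    P = S U^* s^-1 and Q = S^-1 U^*. *)
Lemma pencil_exists n (A B S G U : 'M[C]_n) (g s : 'rV[C]_n) :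
    S^t* = S -> S *m S = A -> S \in unitmx -> G = S *m B *m S ->
    eigdec G U g -> (forall i, s 0 i != 0) -> (forall i, s 0 i ^+ 2 = g 0 i) ->
  exists P Q, pencil A B P Q s.
Proof.
move=> Sh SA Su GE [Uu GU] s0 sg.
have Du : diag_mx s \in unitmx.
  by rewrite unitmxE det_diag unitfE; apply/prodf_neq0.
have gss : diag_mx g = diag_mx s *m diag_mx s.
  rewrite mulmx_diag; congr diag_mx; apply/rowP => i.
  by rewrite mxE -expr2 sg.
have Sih : (invmx S)^t* = invmx S by exact: adjmx_inv.
have UU := unitarymxP Uu.
have GV : S *m B *m S *m U^t* = U^t* *m diag_mx g.
  by rewrite -GE GU -!mulmxA UU mulmx1.
exists (S *m U^t* *m invmx (diag_mx s)), (invmx S *m U^t*); split.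
- by rewrite mulmxKV // -SA -!mulmxA mulKVmx.
- rewrite -[RHS]mulmxA.
  have -> : U^t* *m diag_mx s = U^t* *m diag_mx g *m invmx (diag_mx s).
    by rewrite gss !mulmxA mulmxK.
  by rewrite -GV !mulmxA mulVmx // mul1mx.
- by rewrite adjmxM trmxCK Sih -SA -!mulmxA mulKVmx // mulKmx // UU.
Qed.

Section Pencil.
Variables (n k : nat) (A B : 'M[C]_n) (P Q : 'M[C]_(n, k)) (s : 'rV[C]_k).
Hypotheses (sr : s \is a realmx) (PQ : pencil A B P Q s).

Lemma pencil_QP : Q^t* *m P *m diag_mx s = 1%:M.
Proof. by case: PQ => AQ _ <-; rewrite -!mulmxA AQ. Qed.

Lemma pencil_PQ : P^t* *m Q *m diag_mx s = 1%:M.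
Proof.
apply: mulmx1C; have /(congr1 (fun M : 'M[C]_k => M^t*)) := pencil_QP.
by rewrite !adjmxM trmxCK adjmx_diag // trmx1 map_mx1.
Qed.

Lemma pencil_PBP : P^t* *m B *m P = 1%:M.
Proof. by case: PQ => _ BP _; rewrite -pencil_PQ -!mulmxA BP. Qed.

Lemma pencil_det : `|\det (P^t* *m Q)| = `|\prod_i s 0 i|^-1.
Proof.
have := congr1 (fun M : 'M[C]_k => `|\det M|) pencil_PQ.
rewrite det_mulmx det_diag det1 normrM normr1 => d1.
have p0 : `|\prod_i s 0 i| != 0.
  by apply: contra_eq_neq d1 => ->; rewrite mulr0 eq_sym oner_eq0.
by apply: (mulIf p0); rewrite d1 mulVf.
Qed.

End Pencil.

Lemma pencil_colsub n k l (f : 'I_l -> 'I_k) (A B : 'M[C]_n)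
    (P Q : 'M[C]_(n, k)) s : injective f -> pencil A B P Q s ->
  pencil A B (colsub f P) (colsub f Q) (colsub f s).
Proof.
move=> f_inj [AQ BP QAQ].
have diagE (M : 'M[C]_(n, k)) :
    colsub f M *m diag_mx (colsub f s) = colsub f (M *m diag_mx s).
  by apply/matrixP => i j; rewrite !mul_mx_diag !mxE.
have mulE (N : 'M[C]_n) M : N *m colsub f M = colsub f (N *m M).
  by rewrite mulmx_colsub.
split; rewrite ?diagE ?mulE ?AQ ?BP //.
have -> : (colsub f Q)^t* = rowsub f (Q^t*).
  by apply/matrixP => i j; rewrite !mxE.
rewrite !mul_rowsub_mx mulmx_colsub QAQ.
by apply/matrixP => i j; rewrite !mxE (inj_eq f_inj).
Qed.

(** The Bhatia-Kittaneh inequality, in terms of the pencil. *)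
Lemma pencil_eigenvalueD_ge n (A B P Q U : 'M[C]_n) (s h : 'rV[C]_n)
    (j : 'I_n) :
    A \is hermsymmx -> B \is hermsymmx ->
    (forall v, 0 <= qform A v) -> (forall v, 0 <= qform B v) ->
    s \is a realmx -> pencil A B P Q s ->
    (forall i j : 'I_n, (i <= j)%N -> s 0 j <= s 0 i) -> 0 < s 0 j ->
    eigdec (A + B) U h ->
    (forall i j : 'I_n, (i <= j)%N -> h 0 j <= h 0 i) ->
  2 * s 0 j <= h 0 j.
Proof.
move=> /hermsymmxP hA /hermsymmxP hB A0 B0 sr PQ ss s0 Hd hs.
have [AQ BP QAQ] := PQ; have PBP := pencil_PBP sr PQ.
have QA : Q^t* *m A = (P *m diag_mx s)^t* by rewrite -AQ adjmxM hA.
have PB : P^t* *m B = (Q *m diag_mx s)^t* by rewrite -BP adjmxM hB.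
have XY : (P *m diag_mx s)^t* *m (Q *m diag_mx s) = diag_mx s.
  rewrite adjmxM adjmx_diag // -!mulmxA.
  by rewrite (mulmxA (P^t*)) (pencil_PQ sr PQ) mulmx1.
have YX : (Q *m diag_mx s)^t* *m (P *m diag_mx s) = diag_mx s.
  rewrite adjmxM adjmx_diag // -!mulmxA.
  by rewrite (mulmxA (Q^t*)) (pencil_QP PQ) mulmx1.
move: AQ BP QA PB XY YX; set D := diag_mx s; set X := P *m D; set Y := Q *m D.
move=> AQ BP QA PB XY YX.
pose r := 2 * s 0 j.
have r0 : 0 < r by rewrite mulr_gt0.
have rr : r^* = r by apply: conj_Creal; rewrite gtr0_real.
pose K := X + Y.
(* x = K c = A u + B v, where u = Q c and v = P c; this identity gives
   |x|^2 >= 4 c^* s c. *)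
have KK : K^t* *m K = (X - Y)^t* *m (X - Y) + 4 *: D.
  rewrite adjmxD adjmxB !mulmxDl !mulmxDr !mulmxN !mulNmx XY YX.
  rewrite (_ : 4 *: D = D + D + D + D);
    last by rewrite !scalerDl !scale1r !addrA.
  move: (X^t* *m X) (Y^t* *m Y) => x y.
  by rewrite opprK; apply/matrixP => i j'; rewrite !mxE; ring.
(* Completing the squares: the forms A and B are nonnegative at x - r u and at
   x - r v, and r = 2 s_j is the best choice. *)
have KHK : K^t* *m (A + B) *m K =
    (K - r *: Q)^t* *m A *m (K - r *: Q) + (K - r *: P)^t* *m B *m (K - r *: P)
    + (2 * r) *: (K^t* *m K) - (2 * r ^+ 2) *: 1%:M.
  rewrite !adjmxB !adjmxZ rr !mulmxBl !mulmxBr -!scalemxAl -!scalemxAr.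
  rewrite QAQ PBP QA PB -!(mulmxA (K^t*)) AQ BP mulmxDl mulmxDr.
  have := mulmxDr (K^t*) X Y; have := mulmxDl (X^t*) (Y^t*) K.
  rewrite -adjmxD -/K.
  move: (K^t* *m K) (K^t* *m X) (K^t* *m Y) (X^t* *m K) (Y^t* *m K).
  move: (K^t* *m (A *m K)) (K^t* *m (B *m K)) => u v w x y x' y' -> E.
  have {E}-> : y = x' + y' - x by rewrite E addrAC subrr add0r.
  by apply/matrixP => i j'; rewrite !mxE; ring.
apply: (eigenvalue_ge (j := j) (K := K) Hd) => [i ij|//|c c0 cj].
  exact: hs.
have Kc : 2 * r * sqnormv c <= sqnormv (K *m c).
  rewrite sqnormvM KK qformD -[leLHS]add0r lerD //.
    by rewrite -sqnormvM sqnormv_ge0.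
  rewrite qformZ qform_diag sqnormvE !mulr_sumr ler_sum // => i _.
  rewrite [leRHS]mulrA; case: (leqP i j) => ij.
    rewrite ler_wpM2r ?exprn_ge0 // /r mulrA -natrM ler_wpM2l //.
    exact: ss.
  by rewrite cj // normr0 expr0n !mulr0.
split.
  by rewrite -sqnormv_gt0 (lt_le_trans _ Kc) // !mulr_gt0 // sqnormv_gt0.
rewrite qformM KHK !qformD qformN !qformZ qform1 lerBrDr.
apply: (@le_trans _ _ (2 * r * sqnormv (K *m c))); last first.
  by rewrite sqnormvM lerDr addr_ge0 // -qformM.
have -> : 2 * r * sqnormv (K *m c) =
    r * sqnormv (K *m c) + r * sqnormv (K *m c) by ring.
have -> : 2 * r ^+ 2 * sqnormv c = r * (2 * r * sqnormv c) by ring.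
rewrite lerD2l.
by rewrite ler_wpM2l // ltW.
Qed.

(** Horn's inequality, in terms of the pencil: a and b list the eigenvalues of
    A and B in nondecreasing order. *)
Lemma pencil_prod_le n k (le_kn : (k <= n)%N) (A B U V : 'M[C]_n)
    (a b : 'rV[C]_n) (P Q : 'M[C]_(n, k)) (s : 'rV[C]_k) :
    eigdec A U a -> (forall i, 0 < a 0 i) ->
    (forall i j : 'I_n, (i <= j)%N -> a 0 i <= a 0 j) ->
    eigdec B V b -> (forall i, 0 < b 0 i) ->
    (forall i j : 'I_n, (i <= j)%N -> b 0 i <= b 0 j) ->
    pencil A B P Q s -> (forall i, 0 < s 0 i) ->
  \prod_(i < k) (a 0 (widen_ord le_kn i) * b 0 (widen_ord le_kn i)) <=
  \prod_i (s 0 i ^+ 2).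
Proof.
move=> Ad a0 as_ Bd b0 bs PQ s0; have [_ _ QAQ] := PQ.
have sr : s \is a realmx by apply/mxOverP => i j; rewrite ord1 gtr0_real.
have PBP := pencil_PBP sr PQ.
have /andP[QQ0 QQ] := det_compression le_kn Ad a0 as_ QAQ.
have /andP[PP0 PP] := det_compression le_kn Bd b0 bs PBP.
have Pu : P^t* *m P \in unitmx by rewrite unitmxE unitfE gt_eqF.
have p0 : 0 < \prod_i s 0 i by rewrite prodr_gt0.
have := det_CauchySchwarz Q Pu; rewrite (pencil_det sr PQ) gtr0_norm // => CS.
have {CS QQ0 QQ PP0 PP}/(le_trans CS) := ler_pM (ltW PP0) (ltW QQ0) PP QQ.
rewrite !prodfV -invfM exprVn -prodrXl.
rewrite big_split mulrC /=.
rewrite lef_pV2 ?posrE ?mulr_gt0 ?prodr_gt0 ?exprn_gt0 //.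
by rewrite big_split.
Qed.

End LinearAlgebra.

(** * Sums of negative powers *)

Section Scalars.
Context {R : realType}.

(** Summation by parts: nonnegative partial sums against nonincreasing
    weights. *)
Lemma abel_sum_ge n (w d : 'I_n -> R) (c : R) :
    (forall i j : 'I_n, (i <= j)%N -> w j <= w i) ->
    (forall k (le_kn : (k <= n)%N), 0 <= \sum_(i < k) d (widen_ord le_kn i)) ->
    (forall i, c <= w i) ->
  c * (\sum_i d i) <= \sum_i w i * d i.
Proof.
elim: n w d c => [|n IHn] w d c w_dec d_ge0 cw.
  by rewrite !big_ord0 mulr0.
have sumd : 0 <= \sum_i d i.
  have := d_ge0 _ (leqnn n.+1); congr (_ <= _); apply: eq_bigr => i _.
  by congr d; exact: val_inj.
apply: le_trans (ler_wpM2r sumd (cw ord_max)) _.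
rewrite !big_ord_recr /= mulrDr lerD2r; apply: IHn => [i j ij|k le_kn|i].
- exact: w_dec.
- have := d_ge0 _ (leqW le_kn); congr (_ <= _); apply: eq_bigr => i _.
  by congr d; exact: val_inj.
- by apply: w_dec => /=; rewrite ltnW.
Qed.

Lemma powR_expR (x q : R) : 0 < x -> x `^ q = expR (q * ln x).
Proof. by move=> x0; rewrite /powR gt_eqF. Qed.

(** Multiplicative majorization of s^2 over a b, with s nondecreasing, implies
    an inequality between the sums of powers with exponent q <= 0. *)
Lemma sum_powR_le n (a b s : 'I_n -> R) (q : R) : q <= 0 ->
    (forall i, 0 < a i) -> (forall i, 0 < b i) -> (forall i, 0 < s i) ->
    (forall i j : 'I_n, (i <= j)%N -> s i <= s j) ->
    (forall k (le_kn : (k <= n)%N),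
      \prod_(i < k) (a (widen_ord le_kn i) * b (widen_ord le_kn i)) <=
      \prod_(i < k) s (widen_ord le_kn i) ^+ 2) ->
  2 * \sum_i s i `^ q <= \sum_i a i `^ q + \sum_i b i `^ q.
Proof.
move=> q0 a0 b0 s0 s_inc maj.
pose d i := 2 * ln (s i) - (ln (a i) + ln (b i)).
have d_ge0 k (le_kn : (k <= n)%N) : 0 <= \sum_(i < k) d (widen_ord le_kn i).
  rewrite sumrB subr_ge0 -ler_expR !expR_sum; have := maj k le_kn.
  congr (_ <= _); apply: eq_bigr => i _; first by rewrite expRD !lnK ?posrE.
  by rewrite mulr_natl mulr2n expRD !lnK ?posrE.
have w_dec (i j : 'I_n) : (i <= j)%N -> s j `^ q <= s i `^ q.
  move=> ij; rewrite !powR_expR // ler_expR ler_wnM2l // ler_ln ?posrE //.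
  exact: s_inc.
have := abel_sum_ge w_dec d_ge0 (fun i => powR_ge0 (s i) q).
rewrite mul0r => wd.
(* As a function of ln x, the power x^q is convex and lies above its tangent
   at ln y. *)
have tangent (x y : R) : 0 < x -> 0 < y ->
    y `^ q + q * (y `^ q * (ln x - ln y)) <= x `^ q.
  move=> x0 y0; rewrite [x `^ q]powR_expR // [y `^ q]powR_expR //.
  rewrite (_ : q * ln x = q * ln y + q * (ln x - ln y)); last by ring.
  rewrite expRD; have := expR_ge1Dx (q * (ln x - ln y)).
  by rewrite -(ler_pM2l (expR_gt0 (q * ln y))) mulrDr mulr1 mulrCA.
rewrite -subr_ge0 mulr_sumr -big_split -sumrB /=.
apply: le_trans (_ : - q * \sum_i s i `^ q * d i <= _).
  by rewrite mulr_ge0 // oppr_ge0.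
rewrite mulr_sumr ler_sum // => i _.
have := tangent _ _ (a0 i) (s0 i); have := tangent _ _ (b0 i) (s0 i).
rewrite /d; lra.
Qed.

Lemma ltr_npowR (x y q : R) : q < 0 -> 0 < x -> x < y -> y `^ q < x `^ q.
Proof.
move=> q0 x0 xy; have y0 := lt_trans x0 xy.
by rewrite !powR_expR // ltr_expR ltr_nM2l // ltr_ln.
Qed.

Lemma sqrt_powR (x q : R) : 0 < x -> Num.sqrt x `^ q = x `^ (q / 2).
Proof. by move=> x0; rewrite -powR12_sqrt ?ltW // -powRrM mulrC. Qed.

End Scalars.

Local Open Scope complex_scope.

(** * Powers of positive definite matrices *)

Section Powers.
Context {R : realType}.

Lemma Re_gt0 (z : R[i]) : 0 < z -> 0 < complex.Re z.
Proof. by rewrite ltcE => /andP[]. Qed.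

Lemma ReK (z : R[i]) : 0 < z -> (complex.Re z)%:C = z.
Proof. by move=> /gtr0_real/RRe_real. Qed.

(** The functional calculus does not depend on the spectral decomposition. *)
Lemma mxfun_eigdec n (f : R -> R) (A U : 'M[R[i]]_n) a :
    A \is hermsymmx -> eigdec A U a ->
  eigdec (mxfun f A) U (map_mx (fun z => (f (complex.Re z))%:C) a).
Proof.
move=> hA [Uu AU]; split; first exact: Uu.
have Wu := spectral_unit A.
have /orthomx_spectralP := hermitian_normalmx hA.
rewrite /mxfun; set W := spectralmx A in Wu *; set d := spectral_diag A => AW.
set F := fun z : R[i] => _.
(* The unitary W U^* intertwines the two diagonal matrices of eigenvalues, so
   its entry (i, j) vanishes unless d_i = a_j. *)
have dT : diag_mx d *m (W *m U^t*) = W *m U^t* *m diag_mx a.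
  have WA : diag_mx d *m W = W *m A by rewrite [in RHS]AW -!mulmxA mulKVmx.
  by rewrite mulmxA WA AU -!mulmxA (unitarymxP Uu) mulmx1.
have fdT : diag_mx (map_mx F d) *m (W *m U^t*) =
    W *m U^t* *m diag_mx (map_mx F a).
  apply/matrixP => i j; have /matrixP/(_ i j) := dT.
  rewrite !mul_diag_mx !mul_mx_diag; move: (W *m U^t*) => T; rewrite !mxE.
  have [->|T0] := eqVneq (T i j) 0; first by rewrite !mulr0 !mul0r.
  by rewrite mulrC => /(mulfI T0) ->; rewrite mulrC.
have UU := unitarymxC Uu.
rewrite -[X in _ *m _ *m X]mulmx1 -UU -!mulmxA.
by rewrite (mulmxA W) (mulmxA (diag_mx _)) fdT -!mulmxA mulKmx.
Qed.

Lemma mxtrace_mxfun n (f : R -> R) (A U : 'M[R[i]]_n) a :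
    A \is hermsymmx -> eigdec A U a ->
  \tr (mxfun f A) = (\sum_i f (complex.Re (a 0 i)))%:C.
Proof.
move=> hA /(mxfun_eigdec f hA)/mxtrace_eigdec ->.
by rewrite rmorph_sum; apply: eq_bigr => i _; rewrite mxE.
Qed.

Lemma posdefmx_qform n (A : 'M[R[i]]_n) : posdefmx A ->
  forall v : 'cV_n, 0 <= qform A v.
Proof.
case=> _ A0 v; have [->|/A0/ltW//] := eqVneq v 0.
by rewrite /qform mulmx0 mxE.
Qed.

Lemma posdefmx_eigdec n (A : 'M[R[i]]_n) : posdefmx A ->
  exists U a, [/\ eigdec A U a, forall i, 0 < a 0 i &
    forall i j : 'I_n, (i <= j)%N -> a 0 j <= a 0 i].
Proof.
case=> hA A0; have [U [a [Ad _ a_dec]]] := eigdec_exists hA.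
by exists U, a; split=> // i; exact: eigdec_gt0 Ad A0.
Qed.

Lemma posdefmx_eigdec_inc n (A : 'M[R[i]]_n) : posdefmx A ->
  exists U a, [/\ eigdec A U a, forall i, 0 < a 0 i &
    forall i j : 'I_n, (i <= j)%N -> a 0 i <= a 0 j].
Proof.
case=> hA A0; have hNA : - A \is hermsymmx.
  by move/hermsymmxP: hA => hA; apply/hermsymmxP; rewrite linearN map_mxN hA.
have [U [a [/eigdecN Ad _ a_dec]]] := eigdec_exists hNA.
rewrite opprK in Ad; exists U, (- a); split=> // [i|i j ij].
  exact: eigdec_gt0 Ad A0.
by rewrite !mxE lerN2 a_dec.
Qed.

Lemma posdefmxD n (A B : 'M[R[i]]_n) : posdefmx A -> posdefmx B ->
  posdefmx (A + B).
Proof.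
move=> [/hermsymmxP hA A0] [/hermsymmxP hB B0]; split.
  by apply/hermsymmxP; rewrite adjmxD hA hB.
by move=> v v0; rewrite -/(qform (A + B) v) qformD addr_gt0 ?A0 ?B0.
Qed.

Lemma posdefmx_congr n (S B : 'M[R[i]]_n) : S^t* = S -> S \in unitmx ->
  posdefmx B -> posdefmx (S *m B *m S).
Proof.
move=> hS Su [/hermsymmxP hB B0]; split.
  by apply/hermsymmxP; rewrite !adjmxM hS hB mulmxA.
move=> v v0; rewrite -/(qform _ v) -{1}hS -qformM B0 //.
by apply: contra_neq v0 => Sv; rewrite -[v](mulKmx Su) Sv mulmx0.
Qed.

Lemma mxpowR_sqrt n (A : 'M[R[i]]_n) : posdefmx A ->
  [/\ (mxpowR A (1 / 2))^t* = mxpowR A (1 / 2),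
      mxpowR A (1 / 2) *m mxpowR A (1 / 2) = A & mxpowR A (1 / 2) \in unitmx].
Proof.
move=> pA; have [U [a [Ad a0 _]]] := posdefmx_eigdec pA; have [hA _] := pA.
have Sd := mxfun_eigdec (fun x => x `^ (1 / 2)) hA Ad.
have hS : mxpowR A (1 / 2) \is hermsymmx.
  apply: (eigdec_herm Sd); apply/mxOverP => i j; rewrite mxE.
  by rewrite complex_real.
have SS : mxpowR A (1 / 2) *m mxpowR A (1 / 2) = A.
  apply: (eigdec_inj (eigdec_sqr Sd)); set a2 := \row__ _.
  suff -> : a2 = a by [].
  apply/rowP => i; rewrite !mxE -rmorphM /= -[RHS]ReK //; congr _%:C.
  have ai0 := Re_gt0 (a0 i).
  by rewrite div1r powR12_sqrt ?ltW // -expr2 sqr_sqrtr ?ltW.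
split=> //; first exact/hermsymmxP.
have Au : A \in unitmx.
  rewrite unitmxE (eigdec_det Ad) unitfE; apply/prodf_neq0 => i _.
  by rewrite gt_eqF.
by move: Au; rewrite -{1}SS unitmx_mul => /andP[].
Qed.

Lemma mxtrace_mxpowR n (q : R) (A U : 'M[R[i]]_n) a : posdefmx A ->
  eigdec A U a ->
  \tr (mxpowR A q) = (\sum_i complex.Re (a 0 i) `^ q)%:C.
Proof. by case=> hA _ Ad; exact: (mxtrace_mxfun (fun x => x `^ q) hA Ad). Qed.

Lemma pencil_sqrt n (A B G U : 'M[R[i]]_n) g : posdefmx A ->
    G = mxpowR A (1 / 2) *m B *m mxpowR A (1 / 2) -> eigdec G U g ->
    (forall i, 0 < g 0 i) ->
  exists P Q, pencil A B P Q (map_mx (fun z => (Num.sqrt (complex.Re z))%:C) g).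
Proof.
move=> pA GE Gd g0; have [hS SS Su] := mxpowR_sqrt pA.
apply: (pencil_exists hS SS Su GE Gd) => i; rewrite mxE.
  by rewrite gt_eqF // ltcR sqrtr_gt0 Re_gt0.
by rewrite -rmorphXn /= sqr_sqrtr ?ReK // ltW // Re_gt0.
Qed.

(** Hoelder's inequality for the traces of nonpositive powers. *)
Lemma mxtrace_powR_Hoelder n (A B : 'M[R[i]]_n) (q : R) :
    posdefmx A -> posdefmx B -> q <= 0 ->
  2 * \tr (mxpowR (mxpowR A (1 / 2) *m B *m mxpowR A (1 / 2)) (q / 2)) <=
  \tr (mxpowR A q) + \tr (mxpowR B q).
Proof.
move=> pA pB q0; have [hS SS Su] := mxpowR_sqrt pA.
have pG := posdefmx_congr hS Su pB.
have [G GE] : exists G, G = mxpowR A (1 / 2) *m B *m mxpowR A (1 / 2).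
  by eexists.
rewrite -GE in pG *.
(* Nondecreasing eigenvalues: the smallest ones dominate when q <= 0. *)
have [Ua [a [Ad a0 a_inc]]] := posdefmx_eigdec_inc pA.
have [Ub [b [Bd b0 b_inc]]] := posdefmx_eigdec_inc pB.
have [Ug [g [Gd g0 g_inc]]] := posdefmx_eigdec_inc pG.
have [P [Q PQ]] := pencil_sqrt pA GE Gd g0.
rewrite (mxtrace_mxpowR q pA Ad) (mxtrace_mxpowR q pB Bd).
rewrite (mxtrace_mxpowR (q / 2) pG Gd) -rmorphD /=.
rewrite -[2](rmorph_nat (real_complex R)) -rmorphM /= lecR.
under eq_bigr => i _ do rewrite -sqrt_powR ?Re_gt0 //.
apply: sum_powR_le => // [i|i|i|i j ij|k le_kn]; rewrite ?sqrtr_gt0 ?Re_gt0 //.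
  apply: ler_wsqrtr.
  by have := g_inc _ _ ij; rewrite lecE => /andP[].
have wi : injective (widen_ord le_kn) by move=> i j /(congr1 val) /= /val_inj.
have s0 i : 0 < (colsub (widen_ord le_kn)
    (map_mx (fun z => (Num.sqrt (complex.Re z))%:C) g)) 0 i.
  by rewrite !mxE ltcR sqrtr_gt0 Re_gt0.
have := pencil_prod_le le_kn Ad a0 a_inc Bd b0 b_inc (pencil_colsub wi PQ) s0.
rewrite -lecR !rmorph_prod /=; congr (_ <= _); apply: eq_bigr => i _.
  by rewrite rmorphM /= !ReK.
by rewrite !mxE rmorphXn.
Qed.

(** The arithmetic-geometric mean inequality for eigenvalues. *)
Lemma eigenvalueD_ge n (A B Ug Uh : 'M[R[i]]_n) g h (j : 'I_n) :
    posdefmx A -> posdefmx B ->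
    eigdec (mxpowR A (1 / 2) *m B *m mxpowR A (1 / 2)) Ug g ->
    (forall i, 0 < g 0 i) ->
    (forall i j : 'I_n, (i <= j)%N -> g 0 j <= g 0 i) ->
    eigdec (A + B) Uh h ->
    (forall i j : 'I_n, (i <= j)%N -> h 0 j <= h 0 i) ->
  2 * Num.sqrt (complex.Re (g 0 j)) <= complex.Re (h 0 j).
Proof.
move=> pA pB Gd g0 g_dec Hd h_dec.
have [P [Q PQ]] := pencil_sqrt pA erefl Gd g0.
have [hA _] := pA; have [hB _] := pB.
have [_ pAB] := posdefmxD pA pB.
have h0 := eigdec_gt0 j Hd pAB.
have := pencil_eigenvalueD_ge (j := j) hA hB (posdefmx_qform pA)
  (posdefmx_qform pB) _ PQ _ _ Hd h_dec.
rewrite mxE -[in X in _ -> X]lecR rmorphM rmorph_nat /= ReK //; apply.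
- by apply/mxOverP => i k; rewrite mxE complex_real.
- move=> i k ik; rewrite !mxE lecR; apply: ler_wsqrtr.
  by have := g_dec _ _ ik; rewrite lecE => /andP[].
- by rewrite ltcR sqrtr_gt0 Re_gt0.
Qed.

End Powers.

Theorem proposition6p1 (R : realType) (n : nat) (A B : 'M[R[i]]_n) (q : R)
    (hA : posdefmx A) (hB : posdefmx B) (hq : q < 0) :
  \tr (mxpowR (A + B) q) =
    \tr (mxpowR A q) + \tr (mxpowR B q) +
    (2 `^ q - 2)%:C *
      \tr (mxpowR (mxpowR A (1 / 2) *m B *m mxpowR A (1 / 2)) (q / 2))
  <-> A = B.
Proof.
have [hS SS Su] := mxpowR_sqrt hA.
have pH := posdefmxD hA hB; have pG := posdefmx_congr hS Su hB.
have Hoelder := mxtrace_powR_Hoelder hA hB (ltW hq).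
(* A + B and S B S become variables, so that comparing matrix powers does not
   unfold the functional calculus. *)
have [H HE] : exists H, H = A + B by eexists.
have [G GE] : exists G, G = mxpowR A (1 / 2) *m B *m mxpowR A (1 / 2).
  by eexists.
rewrite -HE in pH *; rewrite -GE in pG Hoelder *.
split=> [trE|AB]; last first.
  have [U [a [Ad a0 _]]] := posdefmx_eigdec hA.
  have Hd : eigdec H U (a + a) by rewrite HE -AB; exact: eigdec_double.
  (* When A = B the matrix G is A^2, and everything commutes. *)
  have Gd : eigdec G U (\row_i (a 0 i * a 0 i)).
    have -> : G = A *m A; last exact: eigdec_sqr.
    rewrite GE -AB; move: SS; set S := mxpowR A _ => SS.
    by rewrite -[X in _ *m X *m _]SS mulmxA SS -mulmxA SS.
  rewrite -AB (mxtrace_mxpowR q pH Hd) (mxtrace_mxpowR q hA Ad).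
  rewrite (mxtrace_mxpowR (q / 2) pG Gd) -rmorphM -!rmorphD /=; congr _%:C.
  rewrite mulr_sumr -!big_split /=; apply: eq_bigr => i _; rewrite !mxE.
  rewrite -(ReK (a0 i)) -rmorphD -rmorphM /=.
  move: (Re_gt0 (a0 i)); set x := complex.Re _ => x0.
  have -> : (x * x) `^ (q / 2) = x `^ q.
    rewrite -expr2 -powR_mulrn ?ltW // -powRrM mulrCA.
    by rewrite divff ?mulr1 ?pnatr_eq0.
  have -> : x + x = 2 * x by ring.
  by rewrite powRM ?ltW //; ring.
have [Ua [a [Ad _ _]]] := posdefmx_eigdec hA.
have [Ub [b [Bd _ _]]] := posdefmx_eigdec hB.
have [Ug [g [Gd g0 g_dec]]] := posdefmx_eigdec pG.
have [Uh [h [Hd h0 h_dec]]] := posdefmx_eigdec pH.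
pose s j := Num.sqrt (complex.Re (g 0 j)).
pose t j := complex.Re (h 0 j).
have st j : 2 * s j <= t j.
  have Gd' := Gd; have Hd' := Hd; rewrite GE in Gd'; rewrite HE in Hd'.
  exact: (eigenvalueD_ge j hA hB Gd' g0 g_dec Hd' h_dec).
have s0 j : 0 < 2 * s j by rewrite mulr_gt0 // sqrtr_gt0 Re_gt0.
have tpow j : t j `^ q <= (2 * s j) `^ q.
  have := st j; rewrite le_eqVlt => /predU1P[->//|lt].
  exact/ltW/ltr_npowR.
(* The assumed equality and the Hoelder inequality reverse the inequality that
   [tpow] gives after summation. *)
have sum_le : \sum_j (2 * s j) `^ q <= \sum_j t j `^ q.
  have -> : \sum_j (2 * s j) `^ q =
      2 `^ q * \sum_j (complex.Re (g 0 j)) `^ (q / 2).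
    rewrite mulr_sumr; apply: eq_bigr => j _.
    by rewrite powRM ?sqrtr_ge0 // sqrt_powR ?Re_gt0.
  move: Hoelder trE.
  rewrite (mxtrace_mxpowR q hA Ad) (mxtrace_mxpowR q hB Bd).
  rewrite (mxtrace_mxpowR (q / 2) pG Gd) (mxtrace_mxpowR q pH Hd).
  rewrite -[2 : R[i]](rmorph_nat (real_complex R)).
  rewrite -!rmorphM -!rmorphD lecR => Hoelder /complexI tE.
  by rewrite /t tE; lra.
have tE j : t j = 2 * s j.
  apply/eqP; case: (ltgtP (t j) (2 * s j)) => //.
    by rewrite ltNge st.
  move=> /(ltr_npowR hq (s0 j)) ltq.
  move: sum_le; rewrite leNgt (bigD1 j) //= [ltRHS](bigD1 j) //=.
  by rewrite ltr_leD // ler_sum.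
have trHH : \tr ((A + B) *m (A + B)) = 4 * \tr (A *m B).
  have -> : \tr (A *m B) = \sum_i g 0 i.
    rewrite -(mxtrace_eigdec Gd) GE -mulmxA [RHS]mxtrace_mulC -mulmxA SS.
    exact: mxtrace_mulC.
  rewrite -HE (mxtrace_eigdec (eigdec_sqr Hd)) mulr_sumr; apply: eq_bigr => j _.
  rewrite mxE -(ReK (h0 j)) -(ReK (g0 j)) -/(t j) tE.
  rewrite -rmorphM -[4](rmorph_nat (real_complex R)) -rmorphM; congr _%:C.
  by rewrite -expr2 exprMn sqr_sqrtr ?ltW ?Re_gt0 // -natrX.
have [/hermsymmxP hA' _] := hA; have [/hermsymmxP hB' _] := hB.
apply/eqP; rewrite -subr_eq0; apply/eqP/mxtrace_adjmx_eq0.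
by rewrite adjmxB hA' hB' mxtrace_sqrB trHH subrr.
Qed.
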